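(* For each positive integer $n$, place $n$ rooks on distinct squares of an $n\times n$ chessboard, uniformly at random among all $\binom{n^2}{n}$ configurations, and let $S_n$ be the number of safe squares. Then the fraction of safe squares $S_n/n^2$ converges in probability to $1/e^2$: for every $\epsilon>0$, $$\lim_{n\to\infty}\mathrm{Prob}\left(\left|\frac{S_n}{n^2}-\frac{1}{e^2}\right|>\epsilon\right)=0.$$
   Context: A configuration $\mathcal{B}$ is a set of $n$ distinct squares of the $n\times n$ board (the squares occupied by rooks); each configuration has probability $1/\binom{n^2}{n}$. A square $(i,j)$, $1\le i,j\le n$, is safe under $\mathcal{B}$ if no rook of $\mathcal{B}$ lies in row $i$ or in column $j$ (in particular $(i,j)$ is not itself occupied). $S_n(\mathcal{B})$ is the number of squares safe under $\mathcal{B}$. *)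

(* Defs.v *)
From mathcomp Require Import all_boot all_order all_algebra.
From mathcomp Require Import all_classical all_reals all_analysis.

Set Implicit Arguments.
Unset Strict Implicit.
Unset Printing Implicit Defensive.

Import Order.TTheory GRing.Theory Num.Theory.
Import numFieldNormedType.Exports.

Local Open Scope ring_scope.

(* (i, j) is the square in row i and column j; indices start at 0. *)
Definition square (n : nat) : finType := ('I_n * 'I_n)%type.

Definition configurations (n : nat) : {set {set square n}} :=
  [set B : {set square n} | #|B| == n].

Definition safe (n : nat) (B : {set square n}) (s : square n) : bool :=
  [forall r in B, (r.1 != s.1) && (r.2 != s.2)].

Definition num_safe (n : nat) (B : {set square n}) : nat :=
  #|[set s : square n | safe B s]|.

Definition Prob (R : realType) (n : nat) (A : pred {set square n}) : R :=
  \sum_(B in configurations n | A B) ('C(n ^ 2, n)%:R)^-1.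

Lemma Prob_total (R : realType) (n : nat) : Prob R (@predT {set square n}) = 1.
Proof.
rewrite /Prob (eq_bigl (mem (configurations n))); last by move=> B; rewrite andbT.
rewrite sumr_const /configurations card_draws card_prod card_ord -mulnn.
rewrite -[LHS]mulr_natl mulfV // pnatr_eq0 -lt0n bin_gt0.
by case: n => // n; rewrite leq_pmulr.
Qed.

(* Main.v *)
Require Import Defs.
From mathcomp Require Import all_boot all_order all_algebra.
From mathcomp Require Import all_classical all_reals all_analysis.
From mathcomp Require Import ring lra zify.
Import Order.TTheory GRing.Theory Num.Theory.
Import numFieldNormedType.Exports.
Local Open Scope classical_set_scope.
Local Open Scope ring_scope.

(** The proof is the second moment method, with an explicit rate.  A square is
    safe exactly when all [n] rooks lie off its row and its column, i.e. in a
    region of [(n - 1) ^ 2] squares; two squares sharing neither row nor column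
    are both safe exactly when all rooks lie in a region of [(n - 2) ^ 2]
    squares.  Hence, with [c = expR (- 2)] and [X] the fraction of safe squares,

    - [E X = 'C((n - 1) ^ 2, n) / 'C(n ^ 2, n)] ([expect_num_safe]);
    - [E X^2 <= 'C((n - 2) ^ 2, n) / 'C(n ^ 2, n) + 2 / n]
      ([expect_num_safe_sqr]), where the error [2 / n] pays for the pairs of
      squares that share a row or a column.

    In the expansion [E (X - c)^2 = E X^2 - 2 c E X + c^2] only an upper bound
    on [E X^2] and a lower bound on [E X] matter, so one-sided estimates of the
    two binomial ratios are enough.  Both come from [1 + x <= expR x]:
    the second ratio is at most [c ^ 2] ([pair_ratio_ub]), and the first is at
    least [c * (1 - 10 / n)] once [6 <= n] ([single_ratio_lb]).  Therefore
    [E (X - c)^2 <= 22 / n] ([mean_square_deviation]), and Chebyshev's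
    inequality bounds the probability by [22 / (n * epsilon ^ 2)]. *)

(** * Ratios of binomial coefficients *)

(** Factor by factor, [(a - i) / (b - i) <= a / b]. *)
Lemma ffact_ratio_ub (a b k : nat) : (a <= b)%N ->
  (a ^_ k * b ^ k <= a ^ k * b ^_ k)%N.
Proof.
move=> ab; elim: k => [|k IHk]; first by rewrite !ffactn0 !expn0.
rewrite !ffactnSr !expnSr [leqLHS]mulnACA [leqRHS]mulnACA.
by apply: leq_mul => //; nia.
Qed.

(** Factor by factor, [(a - N) / (b - N) <= (a - i) / (b - i)] for [i <= N];
    separating the shift [N] from the number of factors [k] lets the induction
    run on [k] alone. *)
Lemma ffact_ratio_lb (a b N k : nat) : (a <= b)%N -> (N <= a)%N -> (k <= N)%N ->
  (b ^_ k * (a - N) ^ k <= (b - N) ^ k * a ^_ k)%N.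
Proof.
move=> ab Na; elim: k => [|k IHk] kN; first by rewrite !ffactn0 !expn0.
rewrite !ffactnSr !expnSr [leqLHS]mulnACA [leqRHS]mulnACA.
by apply: leq_mul; [apply: IHk; exact: ltnW | nia].
Qed.

Lemma bin_ratio_ub (R : realType) (a b k : nat) :
  (a <= b)%N -> (0 < b)%N -> (k <= b)%N ->
  'C(a, k)%:R / 'C(b, k)%:R <= (a%:R / b%:R) ^+ k :> R.
Proof.
move=> ab b0 kb.
have := ffact_ratio_ub a b k ab; rewrite -!bin_ffact => H.
have {}H : ('C(a, k) * b ^ k <= a ^ k * 'C(b, k))%N.
  by rewrite -(leq_pmul2r (fact_gt0 k)) mulnAC -[leqRHS]mulnA.
rewrite expr_div_n ler_pdivrMr ?ltr0n ?bin_gt0// mulrAC.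
by rewrite ler_pdivlMr ?exprn_gt0 ?ltr0n// -!natrX -!natrM ler_nat.
Qed.

Lemma bin_ratio_lb (R : realType) (a b k : nat) : (a <= b)%N -> (k < a)%N ->
  ((a - k)%:R / (b - k)%:R) ^+ k <= 'C(a, k)%:R / 'C(b, k)%:R :> R.
Proof.
move=> ab ka; have kb := leq_trans ka ab.
have := ffact_ratio_lb a b k k ab (ltnW ka) (leqnn k); rewrite -!bin_ffact => H.
have {}H : ('C(b, k) * (a - k) ^ k <= (b - k) ^ k * 'C(a, k))%N.
  by rewrite -(leq_pmul2r (fact_gt0 k)) mulnAC -[leqRHS]mulnA.
rewrite expr_div_n ler_pdivlMr ?ltr0n ?bin_gt0 1?ltnW// mulrAC.
rewrite ler_pdivrMr ?exprn_gt0 ?ltr0n ?subn_gt0//.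
by rewrite -!natrX -!natrM ler_nat mulnC [leqRHS]mulnC.
Qed.

(** The ratio is at most [(1 - 2 / n) ^ (2 n)], and [1 - 2 / n] is at most
    [expR (- 2 / n)]. *)
Lemma pair_ratio_ub (R : realType) (n : nat) : (2 <= n)%N ->
  'C((n - 2) ^ 2, n)%:R / 'C(n ^ 2, n)%:R <= expR (- 2) ^+ 2 :> R.
Proof.
move=> n2; apply: (le_trans (bin_ratio_ub _ _ _ _ _ _ _)); try by nia.
have n0 : n%:R != 0 :> R by rewrite pnatr_eq0; lia.
rewrite !natrX -expr_div_n exprAC lerXn2r ?nnegrE ?exprn_ge0 ?expR_ge0 ?divr_ge0//.
rewrite (_ : expR (- 2) = expR (- 2 / n%:R) ^+ n); last first.
  by rewrite -expRM_natl; congr expR; field.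
rewrite lerXn2r ?nnegrE ?expR_ge0 ?divr_ge0//.
apply: le_trans (expR_ge1Dx _); rewrite natrB// le_eqVlt; apply/orP; left.
by apply/eqP; field.
Qed.

(** The ratio is at least [(u / v) ^ n] for [u = n^2 - 3 n + 1] and
    [v = n^2 - n].  Bounding the inverse [v / u = 1 + (2 n - 1) / u] by an
    exponential gives the lower bound [expR (- 2 - d)] with [d = (5 n - 2) / u];
    here [d <= 10 / n] as soon as [6 <= n]. *)
Lemma single_ratio_lb (R : realType) (n : nat) : (6 <= n)%N ->
  expR (- 2) * (1 - 10 / n%:R) <= 'C((n - 1) ^ 2, n)%:R / 'C(n ^ 2, n)%:R :> R.
Proof.
move=> n6; apply: le_trans (bin_ratio_lb _ _ _ _ _ _); try by nia.
set u : R := ((n - 1) ^ 2 - n)%:R; set v : R := (n ^ 2 - n)%:R.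
set x : R := n%:R.
have uE : u = x ^+ 2 - 3 * x + 1.
  by rewrite /u natrB ?natrX ?natrB//; [ring | lia | nia].
have vE : v = x ^+ 2 - x by rewrite /v natrB ?natrX//; nia.
have x6 : 6 <= x by rewrite (ler_nat R 6).
have nx : n%:R = x by []; clearbody u v x.
have u0 : 0 < u by rewrite uE; nra.
have v0 : 0 < v by rewrite vE; nra.
have uv : expR (- ((2 * x - 1) / u)) <= u / v.
  rewrite expRN -[u / v]invf_div lef_pV2 ?posrE ?divr_gt0 ?expR_gt0//.
  apply: le_trans (expR_ge1Dx _).
  rewrite le_eqVlt; apply/orP; left; apply/eqP; rewrite vE uE.
  by field; rewrite -uE; lra.
apply: (@le_trans _ _ (expR (- ((2 * x - 1) / u)) ^+ n)); last first.
  by rewrite lerXn2r ?nnegrE ?expR_ge0// divr_ge0 ?ltW.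
rewrite -expRM_natl (_ : n%:R * _ = - 2 + - ((5 * x - 2) / u)); last first.
  by rewrite nx uE; field; rewrite -uE; lra.
rewrite expRD ler_pM2l ?expR_gt0//; apply: le_trans (expR_ge1Dx _).
rewrite lerD2l lerN2 ler_pdivrMr// mulrAC ler_pdivlMr; last lra.
by rewrite uE; nra.
Qed.

(** * Expectation under the uniform distribution on configurations *)

Definition expect (R : realType) (n : nat) (X : {set square n} -> R) : R :=
  \sum_(B in configurations n) X B * ('C(n ^ 2, n)%:R)^-1.

Lemma expect_le (R : realType) (n : nat) (X Y : {set square n} -> R) :
  (forall B, X B <= Y B) -> expect R n X <= expect R n Y.
Proof. by move=> XY; apply: ler_sum => B _; rewrite ler_wpM2r ?invr_ge0. Qed.

Lemma expectD (R : realType) (n : nat) (X Y : {set square n} -> R) :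
  expect R n (fun B => X B + Y B) = expect R n X + expect R n Y.
Proof. by rewrite -big_split; apply: eq_bigr => B _; rewrite mulrDl. Qed.

Lemma expectZ (R : realType) (n : nat) (a : R) (X : {set square n} -> R) :
  expect R n (fun B => a * X B) = a * expect R n X.
Proof. by rewrite mulr_sumr; apply: eq_bigr => B _; rewrite mulrA. Qed.

Lemma expect_sum (R : realType) (n : nat) (I : finType)
    (X : I -> {set square n} -> R) :
  expect R n (fun B => \sum_i X i B) = \sum_i expect R n (X i).
Proof.
by rewrite exchange_big; apply: eq_bigr => B _; rewrite mulr_suml.
Qed.

Lemma expect_indicator (R : realType) (n : nat) (A : pred {set square n}) :
  expect R n (fun B => (A B)%:R) = Prob R A.
Proof.
rewrite /Prob big_mkcondr; apply: eq_bigr => B _.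
by case: (A B); rewrite ?mul1r ?mul0r.
Qed.

Lemma expect_cst (R : realType) (n : nat) (a : R) : expect R n (fun=> a) = a.
Proof.
rewrite -[RHS]mulr1 -[X in _ * X](Prob_total R n) -expect_indicator -expectZ.
by apply: eq_bigr => B _; rewrite mulr1.
Qed.

Lemma eq_Prob (R : realType) (n : nat) (A A' : pred {set square n}) :
  A =1 A' -> Prob R A = Prob R A'.
Proof. by move/funext->. Qed.

Lemma Prob_le1 (R : realType) (n : nat) (A : pred {set square n}) : Prob R A <= 1.
Proof.
rewrite -expect_indicator -[leRHS](expect_cst R n); apply: expect_le => B.
by rewrite (ler_nat R _ 1) leq_b1.
Qed.

Lemma chebyshev_ineq (R : realType) (n : nat) (X : {set square n} -> R) (e : R) :
  0 < e ->
  Prob R (fun B => e < `|X B|) <= expect R n (fun B => X B ^+ 2) / e ^+ 2.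
Proof.
move=> e0; rewrite ler_pdivlMr ?exprn_gt0// mulrC -expect_indicator -expectZ.
apply: expect_le => B; case: ltP => [eX|_]; last by rewrite mulr0 sqr_ge0.
rewrite mulr1 -[leRHS]real_normK ?num_real//.
by rewrite lerXn2r ?nnegrE ?normr_ge0 ?(ltW eX) ?(ltW e0).
Qed.

(** * Moments of the number of safe squares *)

(** The events that one square is safe and that two squares are both safe have
    the same form [B \subset unattacked I J], so one count settles both. *)
Definition unattacked (n : nat) (I J : {set 'I_n}) : {set square n} :=
  [set s : square n | (s.1 \notin I) && (s.2 \notin J)].

Lemma card_unattacked (n : nat) (I J : {set 'I_n}) :
  #|unattacked n I J| = ((n - #|I|) * (n - #|J|))%N.
Proof.
rewrite (_ : unattacked n I J = finset.setX (~: I)%SET (~: J)%SET).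
  by rewrite cardsX [in X in (X * _)%N]cardsCs [in X in (_ * X)%N]cardsCs
    !finset.setCK card_ord.
by apply/setP => s; rewrite !inE.
Qed.

Lemma unattackedI (n : nat) (I J I' J' : {set 'I_n}) :
  (unattacked n I J :&: unattacked n I' J')%SET =
  unattacked n (I :|: I')%SET (J :|: J')%SET.
Proof. by apply/setP => s; rewrite !inE !negb_or andbACA. Qed.

Lemma Prob_subset (R : realType) (n : nat) (D : {set square n}) :
  Prob R (fun B => B \subset D) = 'C(#|D|, n)%:R / 'C(n ^ 2, n)%:R.
Proof.
rewrite /Prob sumr_const -[LHS]mulr_natl -cards_draws.
congr (_%:R * _); apply: eq_card => B; rewrite [LHS]unfold_in !inE.
by rewrite andbC.
Qed.

Lemma safeE (n : nat) (B : {set square n}) (s : square n) :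
  safe B s = (B \subset unattacked n [set s.1]%SET [set s.2]%SET).
Proof.
by apply/forall_inP/fintype.subsetP => H r rB; have := H r rB; rewrite !inE.
Qed.

Lemma safe2E (n : nat) (B : {set square n}) (s t : square n) :
  safe B s && safe B t =
  (B \subset unattacked n [set s.1; t.1]%SET [set s.2; t.2]%SET).
Proof.
by rewrite !safeE -finset.subsetI unattackedI.
Qed.

Lemma Prob_safe (R : realType) (n : nat) (s : square n) :
  Prob R (fun B => safe B s) = 'C((n - 1) ^ 2, n)%:R / 'C(n ^ 2, n)%:R.
Proof.
rewrite (@eq_Prob R n _ _ (fun B => safeE n B s)).
by rewrite Prob_subset card_unattacked !cards1 mulnn.
Qed.

Lemma Prob_safe2 (R : realType) (n : nat) (s t : square n) :
  s.1 != t.1 -> s.2 != t.2 ->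
  Prob R (fun B => safe B s && safe B t) =
  'C((n - 2) ^ 2, n)%:R / 'C(n ^ 2, n)%:R.
Proof.
move=> st1 st2; rewrite (@eq_Prob R n _ _ (fun B => safe2E n B s t)).
by rewrite Prob_subset card_unattacked !cards2 st1 st2 mulnn.
Qed.

Lemma num_safeE (R : realType) (n : nat) (B : {set square n}) :
  (num_safe B)%:R = \sum_(s : square n) (safe B s)%:R :> R.
Proof.
rewrite /num_safe -sum1_card natr_sum big_mkcond; apply: eq_bigr => s _.
by rewrite !inE; case: (safe B s).
Qed.

Lemma card_square (n : nat) : #|square n| = (n ^ 2)%N.
Proof. by rewrite card_prod card_ord mulnn. Qed.

Lemma expect_num_safe (R : realType) (n : nat) :
  expect R n (fun B => (num_safe B)%:R) =
  n%:R ^+ 2 * ('C((n - 1) ^ 2, n)%:R / 'C(n ^ 2, n)%:R).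
Proof.
transitivity (expect R n (fun B => \sum_s (safe B s)%:R)).
  by apply: eq_bigr => B _; rewrite num_safeE.
rewrite expect_sum; under eq_bigr do rewrite expect_indicator Prob_safe.
by rewrite sumr_const card_square -[LHS]mulr_natl natrX.
Qed.

(** Fix [s].  The [(n - 1) ^ 2] squares [t] off its row and its column (bounded
    by [n ^ 2]) contribute the same probability each; the remaining [2 n - 1]
    contribute at most [1] each. *)
Lemma expect_num_safe_sqr (R : realType) (n : nat) : (0 < n)%N ->
  expect R n (fun B => (num_safe B)%:R ^+ 2) <=
  n%:R ^+ 4 * ('C((n - 2) ^ 2, n)%:R / 'C(n ^ 2, n)%:R + 2 / n%:R).
Proof.
move=> n0; set p := _ / _.
have p0 : 0 <= p by rewrite divr_ge0.
have -> : expect R n (fun B => (num_safe B)%:R ^+ 2) =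
    \sum_(s : square n) \sum_(t : square n) Prob R (fun B => safe B s && safe B t).
  under eq_bigr do under eq_bigr do rewrite -expect_indicator.
  under eq_bigr do rewrite -expect_sum.
  rewrite -expect_sum; apply: eq_bigr => B _; congr (_ * _).
  rewrite num_safeE expr2 mulr_suml; apply: eq_bigr => s _.
  by rewrite mulr_sumr; apply: eq_bigr => t _; rewrite -mulnb natrM.
have rowE : n%:R ^+ 4 * (p + 2 / n%:R) =
    \sum_(s : square n) (n%:R ^+ 2 * p + 2 * n%:R).
  rewrite sumr_const card_square -[RHS]mulr_natl natrX; field.
  by rewrite pnatr_eq0 -lt0n.
rewrite rowE; apply: ler_sum => s _.
pose D := unattacked n [set s.1]%SET [set s.2]%SET.
rewrite (bigID (mem D)) /=; apply: lerD.
  rewrite (eq_bigr (fun=> p)) => [|t]; last first.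
    by rewrite !inE => /andP[t1 t2]; rewrite Prob_safe2// eq_sym.
  rewrite sumr_const -[leLHS]mulr_natl ler_wpM2r// -natrX ler_nat.
  by rewrite -card_square max_card.
apply: (@le_trans _ _ (\sum_(t | t \notin D) 1)).
  by apply: ler_sum => t _; exact: Prob_le1.
rewrite sumr_const -natrM ler_nat.
rewrite -(leq_add2l #|D|) cardC card_square card_unattacked !cards1; nia.
Qed.

(** With [p1] and [p2] the two binomial ratios, the left-hand side is at most
    [(p2 + 2 / n) - 2 c p1 + c^2 <= 2 / n + 20 c^2 / n], and [c <= 1]. *)
Lemma mean_square_deviation (R : realType) (n : nat) : (6 <= n)%N ->
  expect R n (fun B => ((num_safe B)%:R / n%:R ^+ 2 - expR (- 2)) ^+ 2)
    <= 22 / n%:R.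
Proof.
move=> n6; set c : R := expR (- 2).
have x6 : 6 <= n%:R :> R by rewrite (ler_nat R 6).
have c0 : 0 < c by exact: expR_gt0.
have c1 : c <= 1 by rewrite -expR0 ler_expR oppr_le0.
have := single_ratio_lb R n n6; rewrite -/c => p1.
have := @pair_ratio_ub R n; rewrite -/c => /(_ ltac:(lia)) p2.
have := expect_num_safe R n; have := @expect_num_safe_sqr R n.
move=> /(_ ltac:(lia)); move: p1 p2; set p1 := 'C((n - 1) ^ 2, n)%:R / _; set p2 := 'C((n - 2) ^ 2, n)%:R / _.
set x : R := n%:R in x6 * => p1_lb p2_ub m2 m1.
have x0 : 0 < x by lra.
have -> : expect R n (fun B => ((num_safe B)%:R / x ^+ 2 - c) ^+ 2) =
    x ^- 4 * expect R n (fun B => (num_safe B)%:R ^+ 2)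
    + (- (2 * c / x ^+ 2) * expect R n (fun B => (num_safe B)%:R) + c ^+ 2).
  rewrite -!expectZ -(expect_cst R n (c ^+ 2)) -!expectD.
  by apply: eq_bigr => B _; congr (_ * _); field; lra.
rewrite m1.
have {}m2 : x ^- 4 * expect R n (fun B => (num_safe B)%:R ^+ 2) <= p2 + 2 / x.
  by rewrite mulrC ler_pdivrMr ?exprn_gt0// mulrC.
have -> : - (2 * c / x ^+ 2) * (x ^+ 2 * p1) = - (2 * c * p1) by field; lra.
have : c * (c * (1 - 10 / x)) <= c * p1 by rewrite ler_pM2l.
have -> : 22 / x = 2 / x + 2 * (10 / x) by field; lra.
have : c * c * (10 / x) <= 10 / x.
  by apply: ler_piMl; [rewrite divr_ge0 // ltW | nra].
nra.
Qed.

(** * Convergence in probability *)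

Theorem mainTheorem2 (R : realType) (epsilon : R) (hepsilon : 0 < epsilon) :
  (fun n : nat =>
     Prob R (fun B : {set square n} =>
       epsilon < `| (num_safe B)%:R / (n%:R ^+ 2) - 1 / (expR 1 ^+ 2) |))
  @ \oo --> (0 : R).
Proof.
have -> : 1 / expR 1 ^+ 2 = expR (- 2) :> R.
  by rewrite div1r -expRM_natl mulr1 expRN.
have bound : (fun n : nat => 22 / epsilon ^+ 2 * n%:R^-1) @ \oo --> (0 : R).
  rewrite -[0](mulr0 (22 / epsilon ^+ 2)); apply: cvgMr.
  rewrite -cvg_shiftS; exact: cvg_harmonic.
apply: (squeeze_cvgr _ (cvg_cst 0) bound).
exists 6%N => // n /= n6; apply/andP; split.
  by rewrite -expect_indicator; apply: sumr_ge0 => B _; rewrite mulr_ge0 ?invr_ge0.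
apply: le_trans (chebyshev_ineq _ _ _ _ hepsilon) _.
rewrite mulrAC ler_pM2r ?invr_gt0 ?exprn_gt0//; exact: mean_square_deviation.
Qed.
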